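(* Let $M^2$ be a helicoidal surface (of first type) in the isotropic 3-space $\mathbb{I}^3$ with pitch $h\in\mathbb{R}$, parametrized by $\mathbf{r}(u,v)=(u\cos v,\,u\sin v,\,g(u)+hv)$, $u>0$, and suppose $M^2$ has constant isotropic mean curvature $H_0$, where the isotropic mean curvature is normalized as $H=\frac{g'}{u}+g''$. Then $M^2$ has the form $$\mathbf{r}(u,v)=(u\cos v,\,u\sin v,\,g(u)+hv),\qquad g(u)=\frac{H_0}{4}u^2+\alpha\ln(u)+\beta,$$ for some $\alpha\in\mathbb{R}\setminus\{0\}$ and some constant $\beta\in\mathbb{R}$.
   Context: The isotropic 3-space $\mathbb{I}^3$ is $\mathbb{R}^3$ with affine coordinates $(x_1,x_2,x_3)$ and the degenerate isotropic metric $dx_1^2+dx_2^2$ (the Euclidean metric of the top view $(x_1,x_2,x_3)\mapsto(x_1,x_2,0)$). A helicoidal surface of first type with pitch $h\in\mathbb{R}$ is obtained by rotating a curve $(f(u),0,g(u))$ about the $x_3$-axis with a simultaneous translation along the axis; taking $f(u)=u$, it is parametrized by $\mathbf{r}(u,v)=(u\cos v,u\sin v,g(u)+hv)$, where $u$ ranges over an interval in $(0,\infty)$ and $g$ is of class $C^2$. First fundamental form: $\mathfrak{g}_{11}=1$, $\mathfrak{g}_{12}=0$, $\mathfrak{g}_{22}=u^2$. Second fundamental form, with respect to the normal field $(0,0,1)$: $\mathfrak{h}_{11}=g''$, $\mathfrak{h}_{12}=-h/u$, $\mathfrak{h}_{22}=ug'$. The isotropic mean curvature of such a surface is taken here, without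 the factor $\frac12$, as $$H=\frac{\mathfrak{g}_{11}\mathfrak{h}_{22}-2\mathfrak{g}_{12}\mathfrak{h}_{12}+\mathfrak{g}_{22}\mathfrak{h}_{11}}{\det(\mathfrak{g}_{ij})}=\frac{g'}{u}+g''.$$
   Formalization: The condition α ≠ 0 is asserted only when g is not of the form (H_0/4)u² + c, since for such g (e.g. g = 0, H_0 = 0) α = 0 is forced; the formula for g with real α, β is proved in all cases. *)

(* Defs.v *)
From Stdlib Require Import Reals Lra.
From Coquelicot Require Import Coquelicot.
Open Scope R_scope.

Definition point : Type := (R * R * R)%type.

Definition x1 (p : point) : R := fst (fst p).
Definition x2 (p : point) : R := snd (fst p).
Definition x3 (p : point) : R := snd p.

(** The degenerate metric [dx1^2 + dx2^2]. *)
Definition iso_dot (p q : point) : R := x1 p * x1 q + x2 p * x2 q.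

Definition det3 (p q w : point) : R :=
  x1 p * (x2 q * x3 w - x3 q * x2 w)
  - x2 p * (x1 q * x3 w - x3 q * x1 w)
  + x3 p * (x1 q * x2 w - x2 q * x1 w).

Definition iso_normal : point := (0, 0, 1).

Definition partial_u (r : R -> R -> point) (u v : R) : point :=
  (Derive (fun t => x1 (r t v)) u,
   Derive (fun t => x2 (r t v)) u,
   Derive (fun t => x3 (r t v)) u).

Definition partial_v (r : R -> R -> point) (u v : R) : point :=
  (Derive (fun t => x1 (r u t)) v,
   Derive (fun t => x2 (r u t)) v,
   Derive (fun t => x3 (r u t)) v).

Definition fff11 (r : R -> R -> point) (u v : R) : R :=
  iso_dot (partial_u r u v) (partial_u r u v).
Definition fff12 (r : R -> R -> point) (u v : R) : R :=
  iso_dot (partial_u r u v) (partial_v r u v).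
Definition fff22 (r : R -> R -> point) (u v : R) : R :=
  iso_dot (partial_v r u v) (partial_v r u v).

(** The coefficient of [iso_normal] when [w] is written in the basis
    [r_u], [r_v], [iso_normal] (Cramer's rule).  Applied to the second partial
    derivatives this is the Gauss formula
    [r_ij = Gamma_ij^1 r_u + Gamma_ij^2 r_v + h_ij (0,0,1)]. *)
Definition normal_coef (r : R -> R -> point) (u v : R) (w : point) : R :=
  det3 (partial_u r u v) (partial_v r u v) w
  / det3 (partial_u r u v) (partial_v r u v) iso_normal.

Definition sff11 (r : R -> R -> point) (u v : R) : R :=
  normal_coef r u v (partial_u (partial_u r) u v).
Definition sff12 (r : R -> R -> point) (u v : R) : R :=
  normal_coef r u v (partial_v (partial_u r) u v).
Definition sff22 (r : R -> R -> point) (u v : R) : R :=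
  normal_coef r u v (partial_v (partial_v r) u v).

(** Trace normalization: no factor [1/2]. *)
Definition iso_mean_curvature (r : R -> R -> point) (u v : R) : R :=
  (fff11 r u v * sff22 r u v - 2 * fff12 r u v * sff12 r u v
   + fff22 r u v * sff11 r u v)
  / (fff11 r u v * fff22 r u v - fff12 r u v ^ 2).

Definition helicoidal (g : R -> R) (h : R) (u v : R) : point :=
  (u * cos v, u * sin v, g u + h * v).

Definition is_interval (I : R -> Prop) : Prop :=
  forall x y z, I x -> I z -> x <= y <= z -> I y.

(** [g] is of class C^2 on an open neighbourhood of [I].  For open [I] this is
    C^2 on [I]; at an endpoint belonging to [I] it means that [g] stands for a
    C^2 extension. *)
Definition C2_on (I : R -> Prop) (g : R -> R) : Prop :=
  forall u, I u ->
    locally u (fun x => ex_derive g x /\ ex_derive (Derive g) x /\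
                        continuous (Derive (Derive g)) x).

Lemma partial_u_helicoidal g h t w : ex_derive g t ->
  partial_u (helicoidal g h) t w = (cos w, sin w, Derive g t).
Proof.
intros Hg; unfold partial_u, helicoidal, x1, x2, x3; simpl.
f_equal; [f_equal|]; apply is_derive_unique; auto_derive; trivial; try ring.
change (fun x : R => g x) with g; ring.
Qed.

Lemma partial_v_helicoidal g h t w :
  partial_v (helicoidal g h) t w = (- t * sin w, t * cos w, h).
Proof.
unfold partial_v, helicoidal, x1, x2, x3; simpl.
f_equal; [f_equal|]; apply is_derive_unique; auto_derive; trivial; ring.
Qed.

Lemma partial_uu_helicoidal g h u v
  (hg : locally u (fun x => ex_derive g x)) :
  partial_u (partial_u (helicoidal g h)) u v = (0, 0, Derive (Derive g) u).
Proof.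
unfold partial_u at 1.
f_equal; [f_equal|].
- rewrite (Derive_ext_loc _ (fun _ => cos v)); [apply Derive_const|].
  generalize hg; apply filter_imp; intros y Hy.
  now rewrite partial_u_helicoidal.
- rewrite (Derive_ext_loc _ (fun _ => sin v)); [apply Derive_const|].
  generalize hg; apply filter_imp; intros y Hy.
  now rewrite partial_u_helicoidal.
- apply Derive_ext_loc.
  generalize hg; apply filter_imp; intros y Hy.
  now rewrite partial_u_helicoidal.
Qed.

Lemma partial_uv_helicoidal g h u v
  (hg : locally u (fun x => ex_derive g x)) :
  partial_v (partial_u (helicoidal g h)) u v = (- sin v, cos v, 0).
Proof.
pose proof (locally_singleton _ _ hg) as Hg.
unfold partial_v at 1.
f_equal; [f_equal|].
- rewrite (Derive_ext _ cos); [apply is_derive_unique, is_derive_cos|].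
  intros t; now rewrite partial_u_helicoidal.
- rewrite (Derive_ext _ sin); [apply is_derive_unique, is_derive_sin|].
  intros t; now rewrite partial_u_helicoidal.
- rewrite (Derive_ext _ (fun _ => Derive g u)); [apply Derive_const|].
  intros t; now rewrite partial_u_helicoidal.
Qed.

Lemma partial_vv_helicoidal g h u v :
  partial_v (partial_v (helicoidal g h)) u v = (- u * cos v, - u * sin v, 0).
Proof.
unfold partial_v at 1.
f_equal; [f_equal|].
- rewrite (Derive_ext _ (fun t => - u * sin t)).
  + apply is_derive_unique; auto_derive; trivial; ring.
  + intros t; now rewrite partial_v_helicoidal.
- rewrite (Derive_ext _ (fun t => u * cos t)).
  + apply is_derive_unique; auto_derive; trivial; ring.
  + intros t; now rewrite partial_v_helicoidal.
- rewrite (Derive_ext _ (fun _ => h)); [apply Derive_const|].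
  intros t; now rewrite partial_v_helicoidal.
Qed.

Lemma fundamental_forms_helicoidal g h u v
  (hu : 0 < u) (hg : locally u (fun x => ex_derive g x)) :
  fff11 (helicoidal g h) u v = 1 /\
  fff12 (helicoidal g h) u v = 0 /\
  fff22 (helicoidal g h) u v = u ^ 2 /\
  sff11 (helicoidal g h) u v = Derive (Derive g) u /\
  sff12 (helicoidal g h) u v = - h / u /\
  sff22 (helicoidal g h) u v = u * Derive g u.
Proof.
pose proof (locally_singleton _ _ hg) as Hg.
unfold fff11, fff12, fff22, sff11, sff12, sff22, normal_coef.
rewrite (partial_uu_helicoidal _ _ _ _ hg), (partial_uv_helicoidal _ _ _ _ hg).
rewrite partial_vv_helicoidal, partial_v_helicoidal,
  (partial_u_helicoidal _ _ _ _ Hg).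
unfold iso_dot, det3, iso_normal, x1, x2, x3; simpl.
pose proof (sin2_cos2 v) as E; unfold Rsqr in E.
assert (D : cos v * (u * cos v * 1 - h * 0) - sin v * (- u * sin v * 1 - h * 0)
  + Derive g u * (- u * sin v * 0 - u * cos v * 0) = u).
{ transitivity (u * (sin v * sin v + cos v * cos v)); [ring | rewrite E; ring]. }
rewrite D.
repeat split.
- lra.
- ring.
- transitivity (u ^ 2 * (sin v * sin v + cos v * cos v)); [ring | rewrite E; ring].
- transitivity (u * (sin v * sin v + cos v * cos v) * Derive (Derive g) u / u);
    [field; lra | rewrite E; field; lra].
- transitivity (- h * (sin v * sin v + cos v * cos v) / u);
    [field; lra | rewrite E; field; lra].
- transitivity (u ^ 2 * (sin v * sin v + cos v * cos v) * Derive g u / u);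
    [field; lra | rewrite E; field; lra].
Qed.

Lemma iso_mean_curvature_helicoidal g h u v
  (hu : 0 < u) (hg : locally u (fun x => ex_derive g x)) :
  iso_mean_curvature (helicoidal g h) u v
  = Derive g u / u + Derive (Derive g) u.
Proof.
destruct (fundamental_forms_helicoidal g h u v hu hg)
  as (E1 & E2 & E3 & E4 & E5 & E6).
unfold iso_mean_curvature; rewrite E1, E2, E3, E4, E5, E6.
field; lra.
Qed.

(* Main.v *)
Require Import Defs.
From Stdlib Require Import Reals Lra Classical.
From Coquelicot Require Import Coquelicot.
Open Scope R_scope.

(** The curvature equation [g'/u + g'' = H0], multiplied by [u], says that
    [u g' - H0 u^2 / 2] has zero derivative, hence equals a constant [alpha].
    Then [g - H0 u^2 / 4 - alpha ln u] has zero derivative as well. *)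

(** By the mean value theorem on the segment between the two points, which stays inside [I] because
    [I] is an interval. *)
Lemma is_interval_derive_0_constant (I : R -> Prop) (f : R -> R) :
  is_interval I -> (forall t, I t -> is_derive f t 0) ->
  forall a b, I a -> I b -> f a = f b.
Proof.
intros hI hf.
assert (Hlt : forall a b, I a -> I b -> a < b -> f a = f b).
{ intros a b Ia Ib Hab.
  apply eq_is_derive; [|exact Hab].
  intros t Ht; apply hf; now apply (hI a t b). }
intros a b Ia Ib.
destruct (Rtotal_order a b) as [Hab|[Hab|Hab]].
- now apply Hlt.
- now rewrite Hab.
- symmetry; now apply Hlt.
Qed.

Theorem theorem3p3 (I : R -> Prop) (g : R -> R) (h H0 : R)
  (hI : is_interval I) (hpos : forall u, I u -> 0 < u) (hg : C2_on I g)
  (hH : forall u v, I u -> iso_mean_curvature (helicoidal g h) u v = H0) :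
  exists alpha beta : R,
    (forall u v, I u ->
       helicoidal g h u v
       = (u * cos v, u * sin v,
          (H0 / 4 * u ^ 2 + alpha * ln u + beta) + h * v)) /\
    (~ (exists c : R, forall u, I u -> g u = H0 / 4 * u ^ 2 + c) ->
       alpha <> 0).
Proof.
cut (exists alpha beta : R,
       forall u, I u -> g u = H0 / 4 * u ^ 2 + alpha * ln u + beta).
{ intros (alpha & beta & E); exists alpha, beta; split.
  - intros u v Iu; unfold helicoidal; now rewrite (E u Iu).
  (* With [alpha = 0] the profile is the parabola [H0 / 4 * u ^ 2 + beta], exactly the excluded
     case. *)
  - intros Hc Ha; apply Hc; exists beta.
    intros u Iu; rewrite (E u Iu), Ha; ring. }
(* A base point [u0] fixes both integration constants; over an empty [I] any constants serve. *)
destruct (classic (exists u, I u)) as [[u0 I0]|Hempty].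
2:{ exists 0, 0; intros u Iu; exfalso; apply Hempty; now exists u. }
assert (ode : forall u, I u -> Derive g u / u + Derive (Derive g) u = H0).
{ intros u Iu; rewrite <- (hH u 0 Iu); symmetry.
  apply iso_mean_curvature_helicoidal; [now apply hpos|].
  generalize (hg u Iu); apply filter_imp; now intros x (D1 & _). }
pose (p := fun u => u * Derive g u - H0 / 2 * u ^ 2).
assert (Hp : forall u, I u -> p u = p u0).
{ intros u Iu; apply (is_interval_derive_0_constant I p hI); [|exact Iu|exact I0].
  intros t It; destruct (locally_singleton _ _ (hg t It)) as (_ & D2 & _).
  specialize (hpos t It); unfold p; auto_derive; [exact D2|].
  (* [p' = u (g'/u + g'' - H0)]; replacing [H0] through the equation leaves an identity. *)
  rewrite <- (ode t It); change (fun x => Derive g x) with (Derive g).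
  field; lra. }
pose (q := fun u => g u - H0 / 4 * u ^ 2 - p u0 * ln u).
assert (Hq : forall u, I u -> q u = q u0).
{ intros u Iu; apply (is_interval_derive_0_constant I q hI); [|exact Iu|exact I0].
  intros t It; destruct (locally_singleton _ _ (hg t It)) as (D1 & _ & _).
  specialize (hpos t It).
  (* The coefficient [p u0] is rewritten as its equal [p t] at the fixed point [t], so it is still
     constant under differentiation, and [p t / t] cancels [g' - H0 t / 2]. *)
  unfold q; rewrite <- (Hp t It); auto_derive; [now repeat split|].
  unfold p; change (fun x => g x) with g; field; lra. }
exists (p u0), (q u0); intros u Iu.
rewrite <- (Hq u Iu); unfold q; ring.
Qed.
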